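(* Let $\mathcal A$ be a semiring system and let $\mathcal P,\mathcal P_1$ be $\mathcal A$-systemic modules. If $\mathcal P_1$ is $(\preceq,h)$-projective and there is a $\preceq$-onto homomorphism $\pi:\mathcal P\to\mathcal P_1$ whose null-module kernel $\mathcal K=\ker_{\mathrm{Mod},\mathcal P}\pi$ is $(\preceq,h)$-projective, then $\mathcal P$ also is $(\preceq,h)$-projective.
   Context: Base definitions. Let $\mathcal T$ be a set. A $\mathcal T$-module is a commutative monoid $(\mathcal A,+,0)$ with a scalar multiplication $\mathcal T\times\mathcal A\to\mathcal A$ satisfying $a(\sum_j b_j)=\sum_j ab_j$ (finite sums) and $a0=0$. A negation map on it is a monoid isomorphism $(-):\mathcal A\to\mathcal A$ of order $\le 2$ with $(-)(ab)=a((-)b)$ for $a\in\mathcal T$, $b\in\mathcal A$. Write $b(-)c:=b+((-)c)$, $b^\circ:=b(-)b$, $\mathcal A^\circ:=\{b^\circ:b\in\mathcal A\}$. A pseudo-triple $(\mathcal A,\mathcal T_{\mathcal A},(-))$ is a $\mathcal T$-module with a negation map and a distinguished subset $\mathcal T_{\mathcal A}\subseteq\mathcal A$ (the tangible elements) with $(-)\mathcal T_{\mathcal A}=\mathcal T_{\mathcal A}$; it is a triple if moreover $\mathcal T_{\mathcal A}\cap\mathcal A^\circ=\emptyset$ and $\mathcal T_{\mathcal A}\cup\{0\}$ generates $(\mathcal A,+)$. A surpassing relation $\preceq$ is a pre-order on $\mathcal A$ such that: (i) $c^\circ\succeq 0$ for all $c$; (ii) $b_1\preceq b_2$ implies $(-)b_1\preceq(-)b_2$;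 (iii) $b_1\preceq b_2$ and $b_1'\preceq b_2'$ imply $b_1+b_1'\preceq b_2+b_2'$; (iv) $a\in\mathcal T$ and $b_1\preceq b_2$ imply $ab_1\preceq ab_2$; (v) $a\preceq b$ with $a,b\in\mathcal T_{\mathcal A}$ implies $a=b$. A system (resp. pseudo-system) $(\mathcal A,\mathcal T_{\mathcal A},(-),\preceq)$ is a triple (resp. pseudo-triple) with a surpassing relation such that for each $a\in\mathcal T_{\mathcal A}$ there is a unique $b\in\mathcal T_{\mathcal A}$ with $0\preceq a+b$, namely $b=(-)a$. Put $\mathcal A_{\mathrm{Null}}=\{a\in\mathcal A:a\succeq 0\}$. Ground system and modules. $\mathcal A=(\mathcal A,\mathcal T,(-),\preceq)$ is a fixed semiring system: a system in which $\mathcal A$ is a semiring (with $0$ and $1$), with tangible set $\mathcal T\subseteq\mathcal A$ acting by multiplication. An $\mathcal A$-systemic module is a pseudo-system $(\mathcal M,\mathcal T_{\mathcal M},(-),\preceq)$ (with scalars $\mathcal T$) such that $\mathcal M$ is an $\mathcal A$-module, $\mathcal T_{\mathcal M}$ spans $\mathcal M$, $\mathcal T\mathcal T_{\mathcal M}\subseteq\mathcal T_{\mathcal M}$, $((-)a)m=(-)(am)$ for $a\in\mathcal A$, $m\in\mathcal M$, and $a_1b_1\preceq a_2b_2$ whenever $a_1\preceq a_2$ in $\mathcal A$ and $b_1\preceq b_2$ in $\mathcal M$. The symbol $\preceq$ is used for all surpassing relations. Submodules and kernels carry the restricted operations and relation. Morphisms. A $\preceq$-morphism $\varphi:\mathcal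 M\to\mathcal M'$ is a map with $\varphi(0)=0$, $\varphi((-)b)=(-)\varphi(b)$, $\varphi(b_1+b_2)\preceq\varphi(b_1)+\varphi(b_2)$, $\varphi(ab)=a\varphi(b)$ for $a\in\mathcal T$, and $b\preceq b'\Rightarrow\varphi(b)\preceq\varphi(b')$. A homomorphism is the same with equality $\varphi(b_1+b_2)=\varphi(b_1)+\varphi(b_2)$. For maps, $f\preceq g$ means $f(b)\preceq g(b)$ for all $b$. A map $f:\mathcal M\to\mathcal N$ is $\preceq$-onto if for every $y\in\mathcal N$ there is $x\in\mathcal M$ with $y\preceq f(x)$. Kernel. For a $\preceq$-morphism $f:\mathcal M\to\mathcal N$, a submodule $\mathcal M'\subseteq\mathcal M$ is $f$-null if $f(\mathcal M')\subseteq\mathcal N_{\mathrm{Null}}$; the null-module kernel $\ker_{\mathrm{Mod},\mathcal M}f$ is the sum of all $f$-null submodules of $\mathcal M$. Projectivity. $\mathcal P$ is $(\preceq,h)$-projective if for any $\preceq$-onto homomorphism $h:\mathcal M\to\mathcal M'$ of systemic modules and any $\preceq$-morphism $f:\mathcal P\to\mathcal M'$ there is a $\preceq$-morphism $\tilde f:\mathcal P\to\mathcal M$ with $f\preceq h\tilde f$. *)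

(* Defs.v *)
(* MathComp, with the classical sets of MathComp-Analysis. *)
From HB Require Import structures.
From mathcomp Require Import all_boot all_order all_algebra.
From mathcomp Require Import boolp classical_sets.

Set Implicit Arguments.
Unset Strict Implicit.
Unset Printing Implicit Defensive.

Import GRing.Theory.
Local Open Scope classical_set_scope.
Local Open Scope ring_scope.

Definition add_span (M : nmodType) (X : set M) : set M :=
  [set x | exists s : seq M,
     (forall y, y \in s -> X y) /\ x = \sum_(y <- s) y].

Definition lin_span (R : pzSemiRingType) (M : lSemiModType R) (X : set M) :
    set M :=
  [set x | exists s : seq (R * M),
     (forall p, p \in s -> X p.2) /\ x = \sum_(p <- s) p.1 *: p.2].

Section Systems.

(* The set of scalars is a subset [T] of an ambient type [S]; the values of    *)
(* [act] outside [T] are irrelevant.                                           *)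
Context {S : Type} {M : nmodType}.
Variables (T : set S) (act : S -> M -> M).
Variables (tan : set M) (neg : M -> M) (le : M -> M -> Prop).

Definition scalar_module : Prop := forall a, T a -> nmod_morphism (act a).

Record negation_map : Prop := NegationMap {
  neg_morph : nmod_morphism neg;
  negK : involutive neg;
  neg_act : forall a b, T a -> neg (act a b) = act a (neg b)
}.

Definition quasi_zeros : set M := [set b + neg b | b in setT].

Definition null_elements : set M := [set a | le 0 a].

Record pseudo_triple : Prop := PseudoTriple {
  pseudo_triple_module : scalar_module;
  pseudo_triple_negation : negation_map;
  neg_tangible : neg @` tan = tan
}.

Record triple : Prop := Triple {
  triple_pseudo : pseudo_triple;
  tangible_quasi_zeros : tan `&` quasi_zeros = set0;
  tangible_generate : add_span (tan `|` [set 0]) = setT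
}.

Record surpassing : Prop := Surpassing {
  surp_refl : forall b, le b b;
  surp_trans : forall b c d, le b c -> le c d -> le b d;
  surp_quasi_zero : forall c, le 0 (c + neg c);
  surp_neg : forall b1 b2, le b1 b2 -> le (neg b1) (neg b2);
  surp_add : forall b1 b2 c1 c2,
    le b1 b2 -> le c1 c2 -> le (b1 + c1) (b2 + c2);
  surp_act : forall a b1 b2, T a -> le b1 b2 -> le (act a b1) (act a b2);
  surp_tangible : forall a b, tan a -> tan b -> le a b -> a = b
}.

Definition unique_quasi_negative : Prop :=
  forall a, tan a -> unique (fun b => tan b /\ le 0 (a + b)) (neg a).

Record pseudo_system : Prop := PseudoSystem {
  pseudo_system_triple : pseudo_triple;
  pseudo_system_surpassing : surpassing;
  pseudo_system_unique : unique_quasi_negative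
}.

Record system : Prop := System {
  system_triple : triple;
  system_surpassing : surpassing;
  system_unique : unique_quasi_negative
}.

End Systems.

Record semiringSystem := SemiringSystem {
  ss_sort :> pzSemiRingType;
  ss_tan : set ss_sort;
  ss_neg : ss_sort -> ss_sort;
  ss_le : ss_sort -> ss_sort -> Prop;
  ss_system : system ss_tan *%R ss_tan ss_neg ss_le
}.

(* No condition ties the tangible elements to the module generated by them;    *)
(* this is the structure inherited by all submodules of a systemic module.     *)
Record pseudoModule (A : semiringSystem) := PseudoModule {
  pm_sort :> lSemiModType A;
  pm_tan : set pm_sort;
  pm_neg : pm_sort -> pm_sort;
  pm_le : pm_sort -> pm_sort -> Prop;
  pm_pseudo_system : pseudo_system (@ss_tan A) *:%R pm_tan pm_neg pm_le
}.

Record is_systemic (A : semiringSystem) (M : pseudoModule A) : Prop :=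
  IsSystemic {
    tangible_span : lin_span (@pm_tan A M) = setT;
    scale_tangible : forall (a : A) (m : M),
      ss_tan a -> pm_tan m -> pm_tan (a *: m);
    scale_neg : forall (a : A) (m : M), ss_neg a *: m = pm_neg (a *: m);
    scale_le : forall (a1 a2 : A) (b1 b2 : M),
      ss_le a1 a2 -> pm_le b1 b2 -> pm_le (a1 *: b1) (a2 *: b2)
  }.

Record systemicModule (A : semiringSystem) := SystemicModule {
  sm_pseudo :> pseudoModule A;
  sm_systemic : is_systemic sm_pseudo
}.

Section Morphisms.
Variable A : semiringSystem.

Record morphism_for (M N : pseudoModule A) (r : N -> N -> Prop) (f : M -> N) :
    Prop := MorphismFor {
  morph_zero : f 0 = 0;
  morph_neg : forall b, f (pm_neg b) = pm_neg (f b);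
  morph_add : forall b1 b2, r (f (b1 + b2)) (f b1 + f b2);
  morph_scale : forall (a : A) b, ss_tan a -> f (a *: b) = a *: f b;
  morph_le : forall b1 b2, pm_le b1 b2 -> pm_le (f b1) (f b2)
}.

Definition preceq_morphism (M N : pseudoModule A) (f : M -> N) : Prop :=
  morphism_for (@pm_le A N) f.

Definition homomorphism (M N : pseudoModule A) (f : M -> N) : Prop :=
  morphism_for eq f.

Definition preceq_onto (M N : pseudoModule A) (f : M -> N) : Prop :=
  forall y, exists x, pm_le y (f x).

Definition preceq_h_projective (P : pseudoModule A) : Prop :=
  forall (M M' : systemicModule A) (h : M -> M') (f : P -> M'),
    homomorphism h -> preceq_onto h -> preceq_morphism f ->
    exists2 g : P -> M, preceq_morphism g & forall b, pm_le (f b) (h (g b)).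

End Morphisms.

(* [mem N] is [N] seen as a boolean predicate. *)
Definition submodule (R : pzSemiRingType) (M : lSemiModType R) (N : set M) :
  Prop := GRing.subsemimod_closed (mem N).

Definition sub_type (R : pzSemiRingType) (M : lSemiModType R) (N : set M)
  of submodule N : Type := {x : M | x \in mem N}.

HB.instance Definition _ (R : pzSemiRingType) (M : lSemiModType R) (N : set M)
  (cN : submodule N) := SubChoice.on (sub_type cN).
HB.instance Definition _ (R : pzSemiRingType) (M : lSemiModType R) (N : set M)
    (cN : submodule N) :=
  GRing.SubChoice_isSubLSemiModule.Build R M (mem N) (sub_type cN) cN.

Section Restriction.
Variables (A : semiringSystem) (M : systemicModule A) (N : set M).
Hypothesis cN : submodule N.

Lemma submodule_neg (x : sub_type cN) : pm_neg (val x) \in mem N.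
Proof.
rewrite -[val x]scale1r -(scale_neg (sm_systemic M)).
by have [_ cZ] := cN; apply/cZ/(valP x).
Qed.

Definition sub_tan : set (sub_type cN) := [set x | pm_tan (val x)].
Definition sub_neg (x : sub_type cN) : sub_type cN := SigSub (submodule_neg x).
Definition sub_le (x y : sub_type cN) : Prop := pm_le (val x) (val y).

Lemma sub_pseudo_system :
  pseudo_system (@ss_tan A) *:%R sub_tan sub_neg sub_le.
Proof.
have [[_ [[n0 nD] nK na] nt] [lr lt lq ln la ls ltan] lu] :=
  pm_pseudo_system M.
have tneg (x : M) : pm_tan x -> pm_tan (pm_neg x).
  by move=> tx; rewrite -nt; exists x.
have nKs : involutive sub_neg by move=> x; apply: val_inj; apply: nK.
split; [split|split|] => //.
- by move=> a _; split=> [|x y]; rewrite ?scaler0 ?scalerDr.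
- split=> //; last by move=> a b aT; apply: val_inj; apply: na.
  split; first by apply: val_inj; apply: n0.
  by move=> x y; apply: val_inj; apply: nD.
- apply/seteqP; split=> [_ [x tx <-]|x tx]; first exact: tneg.
  by exists (sub_neg x); [exact: tneg | exact: nKs].
- by move=> b; apply: lr.
- by move=> b c d; apply: lt.
- by move=> c; apply: lq.
- by move=> b c; apply: ln.
- by move=> b1 b2 c1 c2; apply: la.
- by move=> a b c; apply: ls.
- by move=> a b ta tb lab; apply: val_inj; apply: ltan.
- move=> a ta; have [[h1 h2] h3] := lu _ ta; split; first by split.
  by move=> b hb; apply: val_inj; apply: h3.
Qed.

Definition restrict : pseudoModule A := PseudoModule sub_pseudo_system.

End Restriction.

Definition submodule_sum (R : pzSemiRingType) (M : lSemiModType R)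
    (F : set (set M)) : set M := add_span (\bigcup_(N in F) N).

Lemma submodule_sumP (R : pzSemiRingType) (M : lSemiModType R)
    (F : set (set M)) :
  F `<=` @submodule R M -> submodule (submodule_sum F).
Proof.
move=> subF; split; first split.
- by apply/mem_set; exists [::]; rewrite big_nil; split.
- move=> _ _ /set_mem[s [hs ->]] /set_mem[t [ht ->]]; apply/mem_set.
  exists (s ++ t); rewrite big_cat; split=> // y.
  by rewrite mem_cat => /orP[/hs|/ht].
- move=> a _ /set_mem[s [hs ->]]; apply/mem_set.
  exists [seq a *: y | y <- s]; rewrite big_map scaler_sumr; split=> //.
  move=> _ /mapP[y /hs[N FN Ny] ->]; exists N => //; apply/set_mem.
  by case: (subF N FN) => _; apply; apply/mem_set.
Qed.

Section Kernel.
Variables (A : semiringSystem) (M : systemicModule A) (N : pseudoModule A).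
Variable f : M -> N.

Definition null_submodules : set (set M) :=
  [set K | submodule K /\ f @` K `<=` null_elements (@pm_le A N)].

Lemma null_kernel_submodule : submodule (submodule_sum null_submodules).
Proof. by apply: submodule_sumP => K []. Qed.

Definition null_kernel : pseudoModule A := restrict null_kernel_submodule.

End Kernel.

(* Main.v *)
Require Import Defs.
From mathcomp Require Import all_boot all_algebra.
From mathcomp Require Import boolp classical_sets.

(** Projectivity of [P1], applied to the identity of [P1], splits [pi] up to
    the surpassing relation, written [<=] here: there is a morphism
    [s : P1 -> P] with [y <= pi (s y)] for all [y].  Subtraction only exists up
    to quasi-zeros, but this is enough to decompose [P] as if it were a direct sum of the kernel and
    of [P1].  Indeed [k b = b (-) s (pi b)] satisfies
    [pi (k b) >= pi b (-) pi b >= 0], so it lies in the kernel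
    ([null_kernelP]), and
    [b <= b + (s (pi b) (-) s (pi b)) = k b + s (pi b)].

    To lift [f : P -> M'] along [h : M -> M'], lift its restriction to the
    kernel to [u] and lift [f \o s] to [v].  Then [u \o k + v \o pi] is a
    morphism, being built from morphisms by composition, negation and sum, and
    [f b <= f (k b) + f (s (pi b)) <= h (u (k b)) + h (v (pi b))], which is the
    image of [u (k b) + v (pi b)] since [h] is additive. *)

Set Implicit Arguments.
Unset Strict Implicit.
Unset Printing Implicit Defensive.

Import GRing.Theory.
Local Open Scope classical_set_scope.
Local Open Scope ring_scope.

Section PseudoModuleTheory.
Variables (A : semiringSystem) (M : pseudoModule A).
Implicit Types b c d : M.

Lemma pm_surpassing :
  surpassing (@ss_tan A) *:%R (@pm_tan A M) (@pm_neg A M) (@pm_le A M).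
Proof. by case: (pm_pseudo_system M). Qed.

Lemma pm_negation : negation_map (@ss_tan A) *:%R (@pm_neg A M).
Proof. by case: (pm_pseudo_system M) => -[]. Qed.

Lemma pm_le_refl b : pm_le b b.
Proof. exact: (surp_refl pm_surpassing). Qed.

Lemma pm_le_trans c b d : pm_le b c -> pm_le c d -> pm_le b d.
Proof. exact: (surp_trans pm_surpassing). Qed.

Lemma pm_le_add b1 b2 c1 c2 :
  pm_le b1 b2 -> pm_le c1 c2 -> pm_le (b1 + c1) (b2 + c2).
Proof. exact: (surp_add pm_surpassing). Qed.

Lemma pm_le_neg b1 b2 : pm_le b1 b2 -> pm_le (pm_neg b1) (pm_neg b2).
Proof. exact: (surp_neg pm_surpassing). Qed.

Lemma pm_quasi_zero_ge0 c : pm_le 0 (c + pm_neg c).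
Proof. exact: (surp_quasi_zero pm_surpassing). Qed.

Lemma pm_neg0 : pm_neg (0 : M) = 0.
Proof. by case: (neg_morph pm_negation). Qed.

Lemma pm_negD b c : pm_neg (b + c) = pm_neg b + pm_neg c.
Proof. by case: (neg_morph pm_negation) => _; apply. Qed.

Lemma pm_negZ (a : A) b : ss_tan a -> pm_neg (a *: b) = a *: pm_neg b.
Proof. exact: (neg_act pm_negation). Qed.

End PseudoModuleTheory.

Section MorphismTheory.
Variable A : semiringSystem.
Implicit Types M N Q : pseudoModule A.

Lemma homomorphism_preceq M N (f : M -> N) :
  homomorphism f -> preceq_morphism f.
Proof.
by case=> f0 fN fD fZ fle; split=> // b c; rewrite fD; apply: pm_le_refl.
Qed.

Lemma id_preceq_morphism M : preceq_morphism (fun b : M => b).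
Proof. by split=> // b c; apply: pm_le_refl. Qed.

Lemma comp_preceq_morphism M N Q (g : N -> Q) (f : M -> N) :
  preceq_morphism g -> preceq_morphism f ->
  preceq_morphism (fun b => g (f b)).
Proof.
move=> [g0 gN gD gZ gle] [f0 fN fD fZ fle]; split.
- by rewrite f0.
- by move=> b; rewrite fN gN.
- by move=> b c; apply: (pm_le_trans _ (gD _ _)); apply/gle/fD.
- by move=> a b ta; rewrite fZ // gZ.
- by move=> b c /fle/gle.
Qed.

Lemma add_preceq_morphism M N (f g : M -> N) :
  preceq_morphism f -> preceq_morphism g ->
  preceq_morphism (fun b => f b + g b).
Proof.
move=> [f0 fN fD fZ fle] [g0 gN gD gZ gle]; split.
- by rewrite f0 g0 addr0.
- by move=> b; rewrite fN gN pm_negD.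
- by move=> b c; rewrite addrACA; apply: pm_le_add.
- by move=> a b ta; rewrite fZ // gZ // scalerDr.
- by move=> b c bc; apply: pm_le_add; [apply: fle | apply: gle].
Qed.

Lemma neg_preceq_morphism M N (f : M -> N) :
  preceq_morphism f -> preceq_morphism (fun b => pm_neg (f b)).
Proof.
move=> [f0 fN fD fZ fle]; split.
- by rewrite f0 pm_neg0.
- by move=> b; rewrite fN.
- by move=> b c; rewrite -pm_negD; apply/pm_le_neg/fD.
- by move=> a b ta; rewrite fZ // pm_negZ.
- by move=> b c /fle/pm_le_neg.
Qed.

(** Homogeneity is only required for tangible scalars, but these generate [A]
    additively and both sides are additive in the scalar. *)
Lemma homomorphism_scale M N (f : M -> N) (a : A) b :
  homomorphism f -> f (a *: b) = a *: f b.
Proof.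
move=> [f0 _ fD fZ _].
have : add_span (@ss_tan A `|` [set 0]) a.
  by case: (ss_system A) => -[_ _ ->].
move=> [s [hs ->]]; rewrite !scaler_suml (big_morph f fD f0).
apply: eq_big_seq => t /hs [tt|->]; first exact: fZ.
by rewrite !scale0r f0.
Qed.

End MorphismTheory.

Section Submodules.
Variables (A : semiringSystem) (M : systemicModule A) (K : set M).
Hypothesis cK : submodule K.

Lemma val_preceq_morphism :
  preceq_morphism (fun x : restrict cK => val x : M).
Proof. by split=> // b c; apply: pm_le_refl. Qed.

Lemma corestrict_preceq_morphism (N : pseudoModule A) (f : N -> M)
    (fK : forall b, f b \in mem K) :
  preceq_morphism f ->
  preceq_morphism (fun b => SigSub (fK b) : restrict cK).
Proof.
move=> [f0 fN fD fZ fle]; split=> //.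
- exact: val_inj.
- by move=> b; apply/val_inj/fN.
- by move=> a b ta; apply/val_inj/fZ.
Qed.

End Submodules.

Section KernelTheory.
Variables (A : semiringSystem) (M N : systemicModule A) (f : M -> N).
Hypothesis hf : homomorphism f.

Lemma null_preimage_submodule : submodule (f @^-1` null_elements (@pm_le A N)).
Proof.
have [f0 _ fD _ _] := hf.
split; first split.
- by apply/mem_set; rewrite /= f0; apply: pm_le_refl.
- move=> b c /set_mem nb /set_mem nc; apply/mem_set.
  by rewrite /null_elements /= fD -(addr0 (0 : N)); apply: pm_le_add.
- move=> a b /set_mem nb; apply/mem_set.
  rewrite /null_elements /= homomorphism_scale // -(scaler0 N a).
  apply: (scale_le (sm_systemic N)) nb.
  by case: (ss_system A) => _ /surp_refl + _; apply.
Qed.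

(** For a homomorphism into a systemic module the null elements pull back to a
    submodule, so membership in the null-module kernel can be checked on a
    single element. *)
Lemma null_kernelP b :
  pm_le 0 (f b) -> b \in mem (submodule_sum (null_submodules f)).
Proof.
move=> fb; apply/mem_set; exists [:: b]; rewrite big_seq1; split=> // y.
rewrite inE => /eqP ->; exists (f @^-1` null_elements (@pm_le A N)) => //.
by split; [exact: null_preimage_submodule | move=> _ [c nc <-]].
Qed.

(** The substitute for the projection of [M] onto the kernel along a section:
    applying [f] gives an element surpassing the quasi-zero of [f b]. *)
Lemma sub_section_null_kernel (s : N -> M) b :
  (forall y, pm_le y (f (s y))) ->
  b + pm_neg (s (f b)) \in mem (submodule_sum (null_submodules f)).
Proof.
have [_ fN fD _ _] := hf.
move=> fs; apply: null_kernelP; rewrite fD fN.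
apply: pm_le_trans (pm_quasi_zero_ge0 (f b)) _.
by apply: pm_le_add (pm_le_refl _) _; apply/pm_le_neg/fs.
Qed.

End KernelTheory.

Theorem theoremC (A : semiringSystem) (P P1 : systemicModule A) (pi : P -> P1) :
  preceq_h_projective P1 ->
  homomorphism pi -> preceq_onto pi ->
  preceq_h_projective (null_kernel pi) ->
  preceq_h_projective P.
Proof.
move=> projP1 hpi ontopi projK M M' h f hh ontoh mf.
have mpi := homomorphism_preceq hpi.
have [s ms pis] := projP1 _ _ _ _ hpi ontopi (id_preceq_morphism P1).
have kK b := sub_section_null_kernel hpi b pis.
have mk : preceq_morphism (fun b => SigSub (kK b) : null_kernel pi).
  apply: corestrict_preceq_morphism.
  apply: add_preceq_morphism (id_preceq_morphism P) _.
  by apply: neg_preceq_morphism; apply: comp_preceq_morphism.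
have [u mu fu] := projK _ _ _ _ hh ontoh
  (comp_preceq_morphism mf (val_preceq_morphism (null_kernel_submodule pi))).
have [v mv fv] := projP1 _ _ _ _ hh ontoh (comp_preceq_morphism mf ms).
exists (fun b => u (SigSub (kK b)) + v (pi b)).
  exact: add_preceq_morphism (comp_preceq_morphism mu mk)
                             (comp_preceq_morphism mv mpi).
move=> b; rewrite (morph_add hh).
apply: (pm_le_trans _ (pm_le_add (fu (SigSub (kK b))) (fv (pi b)))).
apply: (pm_le_trans _ (morph_add mf _ _)); apply: (morph_le mf) => /=.
(* [b = b + 0], and [0] is surpassed by the quasi-zero of [s (pi b)]. *)
rewrite -{1}[b]addr0 -addrA [pm_neg _ + _]addrC.
exact: pm_le_add (pm_le_refl _) (pm_quasi_zero_ge0 _).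
Qed.
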